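(* Let $n$ be an absolute Lucas pseudoprime to the discriminant $d$ of the form $n=Pqr$ with $q$ and $r$ primes, $q<r$, and $P>1$ an integer all of whose prime factors are less than $q$. Let $p$ be the largest prime dividing $P$. Then there are integers $1\le D<P<C$ such that, with $\Delta=CD-P^2$, \[ q-\delta_q=\frac{(P-\delta_P)(\delta_qP+\delta_rD)}{\Delta},\qquad r-\delta_r=\frac{(P-\delta_P)(\delta_rP+\delta_qC)}{\Delta},\] and \[ \frac{(p-1)P^2-2P}{p+1}<CD<\frac{(p+3)P^2+2P}{p+1}.\]
   Context: Fix an integer $d$ of the form $d=a^2-4b$ with $a>0$, $b$ coprime integers. For integers $a,b$ the Lucas sequence is $U_0(a,b)=0$, $U_1(a,b)=1$, $U_m(a,b)=aU_{m-1}(a,b)-bU_{m-2}(a,b)$. For an odd positive integer $m$, $\delta_m$ denotes the Jacobi symbol $\left(\frac{d}{m}\right)$. An absolute Lucas pseudoprime to the discriminant $d$ is an odd composite integer $n$ with $\gcd(n,d)=1$ such that $U_{n-\delta_n}(a,b)\equiv 0\pmod n$ for all integers $a,b$ with $d=a^2-4b$ and $\gcd(n,db)=1$. *)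

(* Defs.v *)
From HB Require Import structures.
From mathcomp Require Import all_boot all_order all_algebra.

Set Implicit Arguments.
Unset Strict Implicit.
Unset Printing Implicit Defensive.

Import Order.TTheory GRing.Theory Num.Theory.

Local Open Scope ring_scope.

Fixpoint lucasU (a b : int) (m : nat) : int :=
  match m with
  | 0%N => 0
  | m1.+1 => match m1 with
             | 0%N => 1
             | m2.+1 => a * lucasU a b m1 - b * lucasU a b m2
             end
  end.

(* Only meaningful when p is an odd prime. *)
Definition legendre (d : int) (p : nat) : int :=
  if (p %| d)%Z then 0
  else if [exists x : 'I_p, ((x : nat)%:Z ^+ 2 == d %[mod p])%Z] then 1
  else -1.

(* Only meaningful when m is odd and positive; the empty product gives
   jacobi d 1 = 1. *)
Definition jacobi (d : int) (m : nat) : int :=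
  \prod_(p <- primes m) legendre d p ^+ logn p m.

(* The index n - (d/n) is nonnegative since n > 1 and (d/n) is in {-1, 0, 1},
   so absz merely casts it to nat. *)
Definition absolute_lucas_pseudoprime (d : int) (n : nat) : Prop :=
  [/\ odd n, (1 < n)%N && ~~ prime n, coprimez n d &
      forall a b : int, d = a ^+ 2 - 4 * b -> coprimez n (d * b) ->
        (lucasU a b (absz (n%:Z - jacobi d n)%R) = 0 %[mod n])%Z].

(* Main.v *)
Require Import Defs.
From HB Require Import structures.
From mathcomp Require Import all_boot all_order all_algebra.
From mathcomp Require Import cyclic finfield.
From mathcomp Require Import zify ring.

Set Implicit Arguments.
Unset Strict Implicit.
Unset Printing Implicit Defensive.

Import Order.TTheory GRing.Theory Num.Theory.

Local Open Scope ring_scope.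

(** For a prime [q] dividing [n] exactly once, one exhibits [a], [b] with
    [d = a^2 - 4b], [gcd(n, b) = 1], such that [q] divides [U_m(a, b)] only if
    [q - delta_q] divides [m].  To this end let [s^2 = d] in the field with
    [q^2] elements, let [z] have multiplicative order [q - delta_q], and put
    [x = z s / (z - 1)], [y = s / (z - 1)].  Frobenius sends [s] to
    [delta_q s] and [z] to [z^delta_q], so it fixes [x + y], which is therefore
    the residue of an integer [a]; then [s U_m = x^m - y^m] vanishes iff
    [z^m = 1].  By the Chinese remainder theorem [a] can also be taken divisible
    by [n / q], which makes [b] coprime to [n].

    Hence [q - delta_q] divides [Pr - delta_P delta_r] and [r - delta_r] divides
    [Pq - delta_P delta_q]; the quotients are [C] and [D].  Solving the
    resulting linear system gives the two formulas, and the bounds on [CD] say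
    [(p + 1) |Delta| < 2P(P + 1)], which follows from
    [(q - delta_q) |Delta| <= (P + 1)(P + D)] and [p + 1 <= q - delta_q]. *)

(** * Binet's formula and finite fields *)

Lemma lucasU_Binet (R : comPzRingType) (a b : int) (x y : R) (m : nat) :
  x + y = a%:~R -> x * y = b%:~R ->
  (x - y) * (lucasU a b m)%:~R = x ^+ m - y ^+ m.
Proof.
move=> xDy xMy; elim/ltn_ind: m => -[|[|m]] IH.
- by rewrite /= mulr0 subrr.
- by rewrite /= mulr1.
have -> : lucasU a b m.+2 = a * lucasU a b m.+1 - b * lucasU a b m by [].
rewrite intrB !intrM mulrBr !(mulrCA (x - y)) !IH // -xDy -xMy !exprS.
ring.
Qed.

(** A fixed point is a root of ['X^p - 'X], which already has the [p] distinct residues [k%:R] as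
    roots and, over a domain, no more than [p] in all. *)
Lemma fixed_Frobenius (R : idomainType) (p : nat) (x : R) :
  p \in [pchar R] -> x ^+ p = x -> exists2 k, (k < p)%N & x = k%:R.
Proof.
move=> pR xp; have pr_p := pcharf_prime pR.
pose rs : seq R := [seq i%:R | i <- iota 0 p].
have [/mapP[k]|xN] := boolP (x \in rs).
  by rewrite mem_iota add0n => kp ->; exists k.
have szP : size ('X^p - 'X : {poly R}) = p.+1.
  by rewrite size_polyDl size_polyXn // size_polyN size_polyX ltnS prime_gt1.
have Pn0 : 'X^p - 'X != 0 :> {poly R} by rewrite -size_poly_eq0 szP.
suff : (size (x :: rs) < p.+1)%N by rewrite /= size_map size_iota ltnn.
rewrite -szP; apply: max_poly_roots => //.
  rewrite /= rootE !hornerE xp subrr eqxx /=.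
  apply/allP => _ /mapP[k _ ->]; rewrite rootE !hornerE.
  by rewrite -(pFrobenius_autE pR) pFrobenius_aut_nat subrr.
rewrite /= xN map_inj_in_uniq ?iota_uniq // => i j.
rewrite !mem_iota !add0n => ip jp /eqP.
rewrite -subr_eq0 -[i%:R]/(i%:Z%:~R) -[j%:R]/(j%:Z%:~R) -intrB.
by rewrite -(dvdz_pcharf pR) -eqz_mod_dvd !modz_nat !modn_small // => /eqP[].
Qed.

(** The nonzero elements are [#|F|.-1] distinct roots of unity of that order, so one of them is
    primitive. *)
Lemma finField_prim_root (F : finFieldType) :
  exists z : F, #|F|.-1.-primitive_root z.
Proof.
have F1 : (1 < #|F|)%N by exact: finNzRing_gt1.
have /hasP[z _ zP] : has #|F|.-1.-primitive_root [seq x <- enum F | x != 0].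
  apply: has_prim_root.
  - by case: #|F| F1 => [|[]].
  - apply/allP => x; rewrite mem_filter => /andP[x0 _]; apply/unity_rootP.
    by apply: (mulfI x0); rewrite -exprS prednK ?expf_card ?mulr1 // ltnW.
  - by rewrite filter_uniq ?enum_uniq.
  have := cardC1 (0 : F); rewrite cardE => <-.
  rewrite /enum_mem size_filter -filter_predI size_filter.
  by apply/eq_leq/eq_count => x; rewrite !inE andbT.
by exists z.
Qed.

(** With [c = g ^+ k] for a generator [g], the relation [c ^+ q.-1 = 1] forces [q + 1] to divide
    [k]; as [q] is odd, [k] is even. *)
Lemma sqrt_Frobenius_fixed (F : finFieldType) (q : nat) (c : F) :
  odd q -> #|F| = (q ^ 2)%N -> c != 0 -> c ^+ q = c -> exists s, s ^+ 2 = c.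
Proof.
move=> qo cF c0 cq; have [g gP] := finField_prim_root F.
have q0 : (0 < q)%N by case: q qo {cF cq}.
have cq1 : c ^+ q.-1 = 1 by apply: (mulfI c0); rewrite -exprS prednK // mulr1.
have EN : #|F|.-1 = (q.-1 * q.+1)%N by rewrite cF; lia.
have cN : c ^+ #|F|.-1 = 1 by rewrite EN exprM cq1 expr1n.
have [[k /= _] ck] := prim_rootP gP cN.
have : (#|F|.-1 %| k * q.-1)%N.
  by rewrite (prim_order_dvd gP) exprM -ck cq1.
have q1 : (1 < q)%N.
  by have := finNzRing_gt1 F; rewrite cF; case: q {qo cq EN q0 cq1 cF} => [|[]].
rewrite EN mulnC dvdn_pmul2r; last by lia.
move=> /dvdnP[j kE]; exists (g ^+ (j * q.+1./2)).
by rewrite ck kE -exprM -mulnA muln2 even_halfK //= qo.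
Qed.

(** * The Legendre symbol and the rank of a prime in a Lucas sequence *)

Lemma legendreP (d : int) (p : nat) : ~~ (p %| d)%Z ->
  legendre d p = 1 \/ legendre d p = -1.
Proof. by rewrite /legendre => /negPf->; case: ifP; [left|right]. Qed.

(** Frobenius fixes [d], so it sends [s] to [s] or [- s]; it fixes [s] only if [s] lies in the prime
    field, which makes [d] a square modulo [q]. *)
Lemma sqrt_Frobenius (F : fieldType) (q : nat) (d : int) (s : F) :
  q \in [pchar F] -> ~~ (q %| d)%Z -> s ^+ 2 = d%:~R ->
  s ^+ q = (legendre d q)%:~R * s.
Proof.
move=> qF qd s2; rewrite /legendre (negPf qd).
have Fnat k : k%:R ^+ q = k%:R :> F.
  by rewrite -(pFrobenius_autE qF) pFrobenius_aut_nat.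
case: existsP => [[x /eqP /eqP]|noroot].
  rewrite eqz_mod_dvd (dvdz_pcharf qF) rmorphB rmorphXn /= -s2 subr_eq0.
  rewrite eqf_sqr mul1r => /orP[]/eqP.
    by move=> <-; rewrite Fnat.
  move=> /esym/(canRL (@opprK _)) ->.
  by rewrite -(pFrobenius_autE qF) pFrobenius_autN pFrobenius_aut_nat.
have : (s ^+ q) ^+ 2 == s ^+ 2.
  by rewrite exprAC s2 -(pFrobenius_autE qF) rmorph_int.
rewrite eqf_sqr mulN1r => /orP[/eqP sq|/eqP//].
have [k kq sk] := fixed_Frobenius qF sq.
case: noroot; exists (Ordinal kq); apply/eqP/eqP.
by rewrite eqz_mod_dvd (dvdz_pcharf qF) rmorphB rmorphXn /= -s2 sk subrr.
Qed.

(** Only the residue [c] of [a] is prescribed, which leaves [a] free modulo the cofactor of [q]; the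
    residue of [b] follows, since 4 is invertible modulo [q]. *)
Lemma exists_lucas_rank (q : nat) (d : int) :
  prime q -> odd q -> ~~ (q %| d)%Z ->
  exists c : nat, forall a b : int,
    d = a ^+ 2 - 4 * b -> (q %| a - c%:Z)%Z ->
    ~~ (q %| b)%Z /\
    forall m, (q %| lucasU a b m)%Z -> (absz (q%:Z - legendre d q)%R %| m)%N.
Proof.
move=> pr_q oq qd; have [F qF cF] := pPrimePowerField pr_q (isT : 0 < 2)%N.
have q3 : (2 < q)%N by apply: odd_prime_gt2.
have d0 : d%:~R != 0 :> F by rewrite -(dvdz_pcharf qF).
have n2 : 2 != 0 :> F by rewrite -[2]/(2%:Z%:~R) -(dvdz_pcharf qF) dvdzE /= gtnNdvd.
have dq : d%:~R ^+ q = d%:~R :> F by rewrite -(pFrobenius_autE qF) rmorph_int.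
have [s s2] := sqrt_Frobenius_fixed oq cF d0 dq.
have s0 : s != 0 by apply: contraNneq d0 => s0; rewrite -s2 s0 expr0n.
have sq := sqrt_Frobenius qF qd s2.
have [g gP] := finField_prim_root F.
have [e eE [delta deltaE eN]] : exists2 e, absz (q%:Z - legendre d q)%R = e &
    exists2 delta, legendre d q = delta &
      (delta = 1 /\ e = q.-1) \/ (delta = -1 /\ e = q.+1).
  exists (absz (q%:Z - legendre d q)%R) => //; exists (legendre d q) => //.
  by case: (legendreP qd) => ->; [left|right]; split=> //; clear -q3; lia.
rewrite eE; rewrite {}deltaE in sq.
have e1 : (1 < e)%N by clear -q3 eN; lia.
have e_dvd : (e %| #|F|.-1)%N.
  have -> : #|F|.-1 = (q.-1 * q.+1)%N by rewrite cF; clear -q3; lia.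
  by case: eN => -[_ ->]; [exact: dvdn_mulr|exact: dvdn_mull].
have {g gP e_dvd} [z zP] : exists z : F, e.-primitive_root z.
  by exists (g ^+ (#|F|.-1 %/ e)); apply: dvdn_prim_root.
have ze := prim_expr_order zP.
have z1 : z - 1 != 0.
  by rewrite subr_eq0 -[z]expr1 -(prim_order_dvd zP) dvdn1 gtn_eqF.
have z0 : z != 0.
  apply/eqP => z0; move: ze; rewrite z0 expr0n gtn_eqF ?(ltnW e1) //.
  by move/esym/eqP; rewrite oner_eq0.
pose y := s / (z - 1); pose x := z * y.
have y0 : y != 0 by rewrite mulf_neq0 ?invr_neq0.
have xq : (x + y) ^+ q = x + y.
  rewrite /x /y -(pFrobenius_autE qF) rmorphD !rmorphM /= fmorphV rmorphB rmorph1.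
  rewrite /= !pFrobenius_autE sq.
  have q0 := ltnW (ltnW q3); case: eN => -[-> eN]; rewrite eN in ze.
    have -> : z ^+ q = z by rewrite -(prednK q0) exprS ze mulr1.
    by rewrite mul1r.
  (* Here [x + y = s (z + 1) / (z - 1)], and Frobenius negates both [s] and [(z + 1) / (z - 1)]. *)
  have -> : z ^+ q = z^-1 by apply: (mulfI z0); rewrite -exprS ze divff.
  by field; rewrite z0 z1 mulN1r -oppr_eq0 opprB z1.
have [c _ xy] := fixed_Frobenius qF xq.
have xBy : x - y = s by rewrite /x /y; field.
exists c => a b dE qac; have {qac} ac : a%:~R = c%:Z%:~R :> F.
  by apply/eqP; rewrite -subr_eq0 -intrB -(dvdz_pcharf qF).
have xDy : x + y = a%:~R by rewrite xy -[c%:R]/(c%:Z%:~R) ac.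
have xMy : x * y = b%:~R.
  (* Cancelling 4 reduces the claim to [(x + y)^2 - (x - y)^2 = a^2 - d = 4 b]. *)
  apply: (mulfI (mulf_neq0 n2 n2)).
  have -> : 2 * 2 * (x * y) = (x + y) ^+ 2 - (x - y) ^+ 2 by ring.
  rewrite xDy xBy s2 dE rmorphB rmorphXn rmorphM /=; ring.
split; first by rewrite (dvdz_pcharf qF) -xMy (mulf_neq0 (mulf_neq0 z0 y0) y0).
move=> m; rewrite (dvdz_pcharf qF) => /eqP U0.
have := lucasU_Binet m xDy xMy; rewrite U0 mulr0 /x exprMn => /esym/eqP.
rewrite subr_eq0 -{2}[y ^+ m]mul1r (prim_order_dvd zP).
by move/eqP/(mulIf (expf_neq0 m y0)) ->.
Qed.

(** * The Jacobi symbol and the divisibility forced by a pseudoprime *)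

Lemma jacobi_coprime (d : int) (m n : nat) :
  (0 < m)%N -> (0 < n)%N -> coprime m n ->
  jacobi d (m * n) = jacobi d m * jacobi d n.
Proof.
move=> m0 n0 mn; rewrite /jacobi.
have primesE : perm_eq (primes (m * n)) (primes m ++ primes n).
  apply: uniq_perm; first exact: primes_uniq.
    rewrite cat_uniq !primes_uniq andbT /= -coprime_has_primes //.
  by move=> l; rewrite primesM // mem_cat.
rewrite (perm_big _ primesE) big_cat /=; congr (_ * _); apply: eq_big_seq => l.
  rewrite mem_primes => /and3P[pr_l _ lm].
  by rewrite mulnC logn_Gauss // (coprime_dvdl lm).
rewrite mem_primes => /and3P[pr_l _ ln].
by rewrite logn_Gauss // (coprime_dvdl ln) // coprime_sym.
Qed.

Lemma jacobi_prime (d : int) (q : nat) : prime q -> jacobi d q = legendre d q.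
Proof.
by move=> pr_q; rewrite /jacobi primes_prime // big_seq1 logn_prime // eqxx.
Qed.

Lemma jacobi_sign (d : int) (m : nat) : coprimez m d ->
  jacobi d m = 1 \/ jacobi d m = -1.
Proof.
move=> md; rewrite /jacobi.
have {md} : {in primes m, forall l : nat, ~~ (l %| d)%Z}.
  move=> l; rewrite mem_primes => /and3P[pr_l _ lm].
  rewrite dvdzE /= -prime_coprime //; exact: coprimez_dvdl lm md.
elim: (primes m) => [|l s IH] ls; first by rewrite big_nil; left.
rewrite big_cons.
have {}IH := IH (fun i si => ls i (@mem_behead _ (l :: s) i si)).
have [->|->] := legendreP (ls l (mem_head _ _)); first by rewrite expr1n mul1r.
rewrite -signr_odd; case: odd; rewrite ?expr0 ?expr1 ?mul1r ?mulN1r;  last by [].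
by case: IH => ->; [right|left].
Qed.

Lemma pseudoprime_dvd (d : int) (q m : nat) :
  (exists a b : int, d = a ^+ 2 - 4 * b) ->
  absolute_lucas_pseudoprime d (q * m) -> prime q -> coprime q m ->
  (q%:Z - jacobi d q %| m%:Z - jacobi d m)%Z.
Proof.
move=> [a [b dE]] [on /andP[n1 _] nd hU] pr_q qm.
have [oq om] : odd q /\ odd m by apply/andP; rewrite -oddM.
have [q0 m0] : (0 < q)%N /\ (0 < m)%N by apply/andP; rewrite -muln_gt0 ltnW.
have qd : ~~ (q %| d)%Z.
  rewrite dvdzE /= -prime_coprime //; exact: coprimez_dvdl (dvdn_mulr _ _) nd.
have [c cP] := exists_lucas_rank pr_q oq qd.
pose a0 := chinese q m c 0.
(* The shift by an even integer keeps [b'] integral, and [t] is such that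
   [a + 2t] is congruent to [a0] modulo [q m]. *)
pose t : int := (a0%:Z - a) * (q * m).+1./2%:Z.
have tE : 2 * t = (a0%:Z - a) * (q%:Z * m%:Z + 1).
  have : 2 * (q * m).+1./2%:Z = q%:Z * m%:Z + 1 by lia.
  by move=> <-; rewrite /t; ring.
pose a' := a + 2 * t; pose b' := b + t * a + t ^+ 2.
have dE' : d = a' ^+ 2 - 4 * b' by rewrite dE /a' /b'; ring.
have a'E : a' = a0%:Z + (a0%:Z - a) * (q%:Z * m%:Z) by rewrite /a' tE; ring.
have a'q : (q %| a' - c%:Z)%Z.
  have a0c : (q %| a0%:Z - c%:Z)%Z.
    by rewrite -eqz_mod_dvd !modz_nat chinese_modl.
  have -> : a' - c%:Z = (a0%:Z - c%:Z) + (a0%:Z - a) * m%:Z * q%:Z.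
    by rewrite a'E; ring.
  by rewrite rpredD ?dvdz_mull.
have a'm : (m %| a')%Z.
  have a00 : (m %| a0%:Z)%Z by rewrite dvdzE /= /dvdn chinese_modr ?mod0n.
  by rewrite a'E rpredD ?dvdz_mull.
have [qb' rank] := cP _ _ dE' a'q.
have b'n : coprimez (q * m)%N b'.
  rewrite PoszM coprimezMl; apply/andP; split.
    by rewrite /coprimez; move: qb'; rewrite dvdzE /= -prime_coprime.
  (* As [m] divides [a'], [4 * b'] is congruent to [- d] modulo [m], and [d] is coprime to [m]. *)
  have : coprimez m (a' ^+ 2 - d).
    have md : coprimez m d by exact: coprimez_dvdl (dvdn_mull _ _) nd.
    move/dvdzP: a'm => [k ->].
    have -> : (k * m%:Z) ^+ 2 - d = k ^+ 2 * m%:Z * m%:Z + - d by ring.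
    by rewrite /coprimez gcdzMDl -/(coprimez _ _) coprimezN.
  have -> : a' ^+ 2 - d = 4 * b' by rewrite dE'; ring.
  by rewrite coprimezMr => /andP[].
have nU := hU a' b' dE'; rewrite coprimezMr nd b'n in nU.
have qU : (q %| lucasU a' b' (absz ((q * m)%N%:Z - jacobi d (q * m))%R))%Z.
  move/eqP: (nU isT); rewrite eqz_mod_dvd subr0; apply: dvdz_trans.
  by rewrite dvdzE /= dvdn_mulr.
have := rank _ qU; rewrite -jacobi_prime // -dvdzE jacobi_coprime // PoszM.
(* The index is [m (q - delta_q) + delta_q (m - delta_m)], and [delta_q] is a unit. *)
have [qs|qs] := jacobi_sign (coprimez_dvdl (dvdn_mulr m (dvdnn q)) nd).
  have -> : q%:Z * m%:Z - jacobi d q * jacobi d m =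
      m%:Z * (q%:Z - jacobi d q) + (m%:Z - jacobi d m) by rewrite qs; ring.
  by rewrite rpredDl ?dvdz_mull.
have -> : q%:Z * m%:Z - jacobi d q * jacobi d m =
    m%:Z * (q%:Z - jacobi d q) - (m%:Z - jacobi d m) by rewrite qs; ring.
by rewrite rpredBl ?dvdz_mull.
Qed.

(** * The linear system for the cofactors and the bounds *)

(** This is Cramer's rule in [x] and [y], kept free of division. It is applied to [x = q - delta_q],
    [y = r - delta_r], [K = P - delta_P]. *)
Lemma cofactor_identities (R : comPzRingType) (x y C D P K f g : R) :
  C * x - P * y = g * K -> D * y - P * x = f * K ->
  x * (C * D - P ^+ 2) = K * (f * P + g * D) /\
  y * (C * D - P ^+ 2) = K * (g * P + f * C).
Proof.
move=> Cx Dy; split.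
  have -> : x * (C * D - P ^+ 2) = D * (C * x - P * y) + P * (D * y - P * x).
    by ring.
  by rewrite Cx Dy; ring.
have -> : y * (C * D - P ^+ 2) = C * (D * y - P * x) + P * (C * x - P * y).
  by ring.
by rewrite Cx Dy; ring.
Qed.

Theorem theorem4 (d : int) (n P q r p : nat)
  (hd : exists a b : int, [/\ 0 < a, coprimez a b & d = a ^+ 2 - 4 * b])
  (hn : absolute_lucas_pseudoprime d n)
  (hnPqr : n = (P * q * r)%N)
  (hq : prime q) (hr : prime r) (hqr : (q < r)%N)
  (hP : (1 < P)%N)
  (hPq : forall l : nat, prime l -> (l %| P)%N -> (l < q)%N)
  (hp : prime p) (hpP : (p %| P)%N)
  (hpmax : forall l : nat, prime l -> (l %| P)%N -> (l <= p)%N) :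
  exists C D : int,
    [/\ 1 <= D, D < P%:Z & P%:Z < C] /\
    let Delta : int := C * D - P%:Z ^+ 2 in
    [/\ Delta != 0,
        (q%:Z - jacobi d q)%:~R =
          ((P%:Z - jacobi d P) * (jacobi d q * P%:Z + jacobi d r * D))%:~R
          / Delta%:~R :> rat,
        (r%:Z - jacobi d r)%:~R =
          ((P%:Z - jacobi d P) * (jacobi d r * P%:Z + jacobi d q * C))%:~R
          / Delta%:~R :> rat,
        ((p%:R - 1) * P%:R ^+ 2 - 2 * P%:R) / (p%:R + 1) < (C * D)%:~R :> rat &
        (C * D)%:~R < ((p%:R + 3) * P%:R ^+ 2 + 2 * P%:R) / (p%:R + 1) :> rat].
Proof.
have [hon _ hnd _] := hn.
have [oP oq r_odd] : [/\ odd P, odd q & odd r].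
  by move: hon; rewrite hnPqr !oddM => /andP[/andP[]].
have cPq : coprime P q.
  rewrite coprime_sym prime_coprime //; apply/negP => /(hPq _ hq).
  by rewrite ltnn.
have cPr : coprime P r.
  rewrite coprime_sym prime_coprime //; apply/negP => /(hPq _ hr) /(ltn_trans hqr).
  by rewrite ltnn.
have cqr : coprime q r by rewrite prime_coprime // dvdn_prime2 // ltn_eqF.
have [P0 q0 r0] : [/\ 0 < P, 0 < q & 0 < r]%N by split; [exact: ltnW|exact: prime_gt0|exact: prime_gt0].
have hd' : exists a b : int, d = a ^+ 2 - 4 * b.
  by case: hd => a [b [_ _ dE]]; exists a, b.
have eq_n : n = (q * (P * r))%N by rewrite hnPqr mulnCA mulnA.
have er_n : n = (r * (P * q))%N by rewrite hnPqr mulnC.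
have sq : jacobi d q = 1 \/ jacobi d q = -1.
  by apply: jacobi_sign; apply: coprimez_dvdl hnd; rewrite eq_n dvdn_mulr.
have sr : jacobi d r = 1 \/ jacobi d r = -1.
  by apply: jacobi_sign; apply: coprimez_dvdl hnd; rewrite er_n dvdn_mulr.
have sP : jacobi d P = 1 \/ jacobi d P = -1.
  by apply: jacobi_sign; apply: coprimez_dvdl hnd; rewrite hnPqr -mulnA dvdn_mulr.
have /dvdzP[C CE] : (q%:Z - jacobi d q %| P%:Z * r%:Z - jacobi d P * jacobi d r)%Z.
  rewrite -PoszM -jacobi_coprime //; apply: pseudoprime_dvd => //.
    by rewrite -eq_n.
  by rewrite coprimeMr cqr coprime_sym cPq.
have /dvdzP[D DE] : (r%:Z - jacobi d r %| P%:Z * q%:Z - jacobi d P * jacobi d q)%Z.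
  rewrite -PoszM -jacobi_coprime //; apply: pseudoprime_dvd => //.
    by rewrite -er_n.
  by rewrite coprimeMr coprime_sym cPr coprime_sym cqr.
(* Both primes are odd, so [p < q] leaves a gap of 2; this yields [p + 1 <= q - delta_q]. *)
have pq : (p.+2 <= q)%N.
  have op : odd p by apply: dvdn_odd hpP oP.
  by have := hPq _ hp hpP; lia.
have qr : (q.+2 <= r)%N by lia.
have p2 : (1 < p)%N by exact: prime_gt1.
set e := jacobi d P in sP CE DE *; set f := jacobi d q in sq CE DE *.
set g := jacobi d r in sr CE DE *.
move: sP sq sr CE DE; move: e f g => e f g sP sq sr CE DE.
have [xE yE] : (q%:Z - f) * (C * D - P%:Z ^+ 2) = (P%:Z - e) * (f * P%:Z + g * D) /\
    (r%:Z - g) * (C * D - P%:Z ^+ 2) = (P%:Z - e) * (g * P%:Z + f * C).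
  by apply: cofactor_identities; rewrite -?CE -?DE; ring.
have x0 : 0 < q%:Z - f by lia.
have y0 : 0 < r%:Z - g by lia.
have K0 : 0 < P%:Z - e by lia.
(* The bounds on [C] and [D] are read off after multiplying by [q - f] and [r - g]; the next
   inequalities supply the products that linear arithmetic treats as atoms. *)
have Px : P%:Z * (q%:Z - f) <= P%:Z * (q%:Z + 1) by rewrite ler_wpM2l //; lia.
have Py : P%:Z * (q%:Z + 1) <= P%:Z * (r%:Z - g) by rewrite ler_wpM2l //; lia.
have Pr : P%:Z * (q%:Z + 2) <= P%:Z * r%:Z by rewrite ler_wpM2l //; lia.
have Pq : P%:Z * 1 <= P%:Z * q%:Z by rewrite ler_wpM2l //; lia.
have ef : e * f = 1 \/ e * f = -1 by case: sP sq => [->|->] [->|->]; lia.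
have eg : e * g = 1 \/ e * g = -1 by case: sP sr => [->|->] [->|->]; lia.
have D0 : 0 < D by rewrite -(pmulr_lgt0 _ y0) -DE; lia.
have DP : D < P%:Z by rewrite -(ltr_pM2r y0) -DE; lia.
have PC : P%:Z < C by rewrite -(ltr_pM2r x0) -CE; lia.
(* Since [0 < D < P], the two signed terms cannot cancel; hence Delta is nonzero. *)
have S0 : 0 < `|f * P%:Z + g * D| < 2 * P%:Z.
  by case: sq sr => [->|->] [->|->]; lia.
have Delta_neq0 : C * D - P%:Z ^+ 2 != 0.
  apply/eqP => Delta0; move/esym/eqP: xE; rewrite Delta0 mulr0 mulf_eq0 gt_eqF //=.
  by move/eqP=> Z; rewrite Z normr0 ltxx in S0.
have Delta_lt : (p%:Z + 1) * `|C * D - P%:Z ^+ 2| < (P%:Z + 1) * (2 * P%:Z).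
  apply: (@le_lt_trans _ _ ((q%:Z - f) * `|C * D - P%:Z ^+ 2|)).
    by rewrite ler_wpM2r //; lia.
  rewrite -{1}(gtr0_norm x0) -normrM xE normrM (gtr0_norm K0).
  apply: (@lt_le_trans _ _ ((P%:Z - e) * (2 * P%:Z))).
    by rewrite ltr_pM2l //; case/andP: S0.
  by rewrite ler_wpM2r //; lia.
have [lo hi] : (p%:Z - 1) * P%:Z ^+ 2 - 2 * P%:Z < C * D * (p%:Z + 1) /\
    C * D * (p%:Z + 1) < (p%:Z + 3) * P%:Z ^+ 2 + 2 * P%:Z.
  have p1 : 0 < p%:Z + 1 by lia.
  (* Adding [(p + 1) P^2] to both sides of [-2P(P + 1) < (p + 1) Delta < 2P(P + 1)] gives the two
     numerators. *)
  move: Delta_lt; rewrite -{1}(gtr0_norm p1) -normrM ltr_norml => /andP[].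
  by clear; lia.
have p1 : 0 < p%:R + 1 :> rat by rewrite ltr_wpDl.
exists C, D; split=> //= ; split=> //.
- by apply: (canRL (mulfK _)); rewrite ?intr_eq0 // -intrM xE.
- by apply: (canRL (mulfK _)); rewrite ?intr_eq0 // -intrM yE.
- rewrite ltr_pdivrMr //; move: lo.
  by rewrite -(ltr_int rat) !(intrB, intrD, intrM).
- rewrite ltr_pdivlMr //; move: hi.
  by rewrite -(ltr_int rat) !(intrB, intrD, intrM).
Qed.
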